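(* Let $G$ be a finite graph with a total order $\prec$ on $E(G)$, and let $\alpha$ be a $\{0,1\}$-assigning of $G$. Suppose there exist a finite Abelian group $A$ and a locally zero-sum function $b\in Z(G,A)$ such that $\alpha=\alpha_{G,b}$, and write the $\alpha$-assigning polynomial as \[ F(G,\alpha;k)=\sum_{i=0}^{m(G)}(-1)^i a_i(G,\alpha)\,k^{m(G)-i}. \] Then each $a_i(G,\alpha)$ is the number of subsets $S$ of $E(G)$ having $i$ edges such that $G-S$ is $b$-compatible and $S$ contains no $b$-compatible broken bonds with respect to $\prec$.
   Context: Graphs are finite with vertex set $V(G)$ and edge set $E(G)$; multiple edges and loops are allowed. $c(G)$ is the number of connected components of $G$ (a graph with no vertices has $0$ components) and $m(G)=|E(G)|-|V(G)|+c(G)$. For $S\subseteq E(G)$, $G-S$ is the spanning subgraph obtained by deleting the edges in $S$. For $X\subseteq V(G)$, $G[X]$ and $G-X$ are the vertex-induced subgraphs on $X$ and $V(G)\setminus X$. Let $A$ be a finite additive Abelian group. Fix an arbitrary edge orientation of $G$. For $v\in V(G)$ let $E^+(v)$ (resp. $E^-(v)$) be the set of edges whose head (resp. tail) is $v$ (a loop at $v$ belongs to both). The boundary of $f\in A^{E(G)}$ is $\partial f\in A^{V(G)}$, $\partial f(v)=\sum_{e\in E^+(v)}f(e)-\sum_{e\in E^-(v)}f(e)$. For $b\in A^{V(G)}$, an $(A,b)$-flow is an $f\in A^{E(G)}$ with $\partial f=b$; it is nowhere-zero if $f(e)\neq 0$ for all $e\in E(G)$. $F^*(G,b;A)$ is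 the number of nowhere-zero $(A,b)$-flows of $G$ (independent of the orientation). A function $b\in A^{V(G)}$ is locally zero-sum on a graph $H$ with vertex set $V(G)$ if $\sum_{v\in V(C)}b(v)=0$ for every connected component $C$ of $H$; in that case $H$ is called $b$-compatible. $Z(G,A)$ is the set of all $b\in A^{V(G)}$ that are locally zero-sum on $G$. $\Lambda(G)$ is the family of nonempty $X\subseteq V(G)$ such that $G[X]$ is connected and $c(G-X)=c(G)$. A $\{0,1\}$-assigning of $G$ is a map $\alpha:\Lambda(G)\to\{0,1\}$. Each $b\in A^{V(G)}$ induces the $\{0,1\}$-assigning $\alpha_{G,b}$ with $\alpha_{G,b}(X)=0$ if $\sum_{v\in X}b(v)=0$ and $\alpha_{G,b}(X)=1$ otherwise. By a theorem of Kochol, if $\alpha=\alpha_{G,b}$ for some finite Abelian group $A$ and $b\in Z(G,A)$, there is a (unique) polynomial $F(G,\alpha;k)$ in $k$, of degree at most $m(G)$, such that $F(G,\alpha;k)=F^*(G,b';A')$ for every Abelian group $A'$ of order $k$ and every $b'\in Z(G,A')$ with $\alpha_{G,b'}=\alpha$; it is called the $\alpha$-assigning polynomial of $G$. A bond of $G$ is a minimal nonempty edge cut, i.e. a minimal nonempty set of edges whose removal increases the number of components. For $b\in Z(G,A)$, a $b$-compatible bond of $G$ is a bond $S$ of $G$ such that $G-S$ is $b$-compatible. A $b$-compatible broken bond is a set of edges obtained from a $b$-compatible bond by removing its maximal element with respect to $\prec$ (it may be empty). *)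

(* Defs.v *)
From mathcomp Require Import all_boot all_order all_algebra.

Set Implicit Arguments.
Unset Strict Implicit.
Unset Printing Implicit Defensive.

Import GRing.Theory.
Local Open Scope ring_scope.

(* Finite multigraphs (loops and parallel edges allowed), given together with
   a reference orientation: src e is the tail and tgt e the head of the edge e.
   Only boundary depends on the orientation, the rest on the set of ends. *)
Record mgraph := MGraph {
  vert : finType;
  edge : finType;
  src : edge -> vert;
  tgt : edge -> vert
}.

Definition adj (G : mgraph) : rel (vert G) := fun u v =>
  [exists e : edge G, ((src e == u) && (tgt e == v))
                   || ((src e == v) && (tgt e == u))].

Definition components (G : mgraph) : {set {set vert G}} :=
  [set [set v | connect (@adj G) u v] | u : vert G].

Definition ncomp (G : mgraph) : nat := #|components G|.

(* The truncated subtraction is harmless because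
   |V(G)| <= |E(G)| + c(G) holds in every graph. *)
Definition betti (G : mgraph) : nat := (#|edge G| + ncomp G - #|vert G|)%N.

Definition del_edges (G : mgraph) (S : {set edge G}) : mgraph :=
  @MGraph (vert G) {e : edge G | e \notin S}
    (fun e => src (val e)) (fun e => tgt (val e)).

Definition induced (G : mgraph) (X : {set vert G}) : mgraph :=
  @MGraph {v : vert G | v \in X}
    {e : edge G | (src e \in X) && (tgt e \in X)}
    (fun e => exist _ (src (val e)) (proj1 (andP (valP e))))
    (fun e => exist _ (tgt (val e)) (proj2 (andP (valP e)))).

(* G - X is the subgraph induced on the complement of X. *)
Definition Lambda (G : mgraph) : {set {set vert G}} :=
  [set X | [&& X != set0, ncomp (induced X) == 1%N
             & ncomp (induced (~: X)) == ncomp G]].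

Definition assigning (G : mgraph) : Type :=
  {ffun {X : {set vert G} | X \in Lambda G} -> bool}.

(* true stands for 1 and false for 0. *)
Definition induced_assigning (G : mgraph) (A : finZmodType)
    (b : {ffun vert G -> A}) : assigning G :=
  [ffun X : {X : {set vert G} | X \in Lambda G} =>
     \sum_(v in val X) b v != 0].

Definition locally_zero_sum (H : mgraph) (A : finZmodType)
    (b : {ffun vert H -> A}) : bool :=
  [forall C in components H, \sum_(v in C) b v == 0].

Definition Zsum (G : mgraph) (A : finZmodType) : {set {ffun vert G -> A}} :=
  [set b | locally_zero_sum b].

Definition boundary (G : mgraph) (A : finZmodType)
    (f : {ffun edge G -> A}) : {ffun vert G -> A} :=
  [ffun v => \sum_(e | tgt e == v) f e - \sum_(e | src e == v) f e].

Definition num_nz_flows (G : mgraph) (A : finZmodType)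
    (b : {ffun vert G -> A}) : nat :=
  #|[set f : {ffun edge G -> A} | (boundary f == b) && [forall e, f e != 0]]|.

(* When alpha is induced by some b in
   Z(G, A), such a polynomial exists (Kochol) and is unique, since alpha is then
   also induced over A x Z_n for every n >= 1. *)
Definition is_assigning_polynomial (G : mgraph) (alpha : assigning G)
    (F : {poly rat}) : Prop :=
  (size F <= (betti G).+1)%N /\
  forall (A : finZmodType) (b : {ffun vert G -> A}),
    b \in Zsum G A -> induced_assigning b = alpha ->
    F.[#|A|%:R] = (num_nz_flows b)%:R.

Definition bond (G : mgraph) (S : {set edge G}) : bool :=
  minset (fun T : {set edge G} =>
            (T != set0) && (ncomp G < ncomp (del_edges T))%N) S.

Definition compatible_del (G : mgraph) (A : finZmodType)
    (b : {ffun vert G -> A}) (S : {set edge G}) : bool :=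
  @locally_zero_sum (del_edges S) A b.

Definition compatible_bond (G : mgraph) (A : finZmodType)
    (b : {ffun vert G -> A}) (S : {set edge G}) : bool :=
  bond S && compatible_del b S.

(* ple is the non-strict version of the order on the edges. *)
Definition compatible_broken_bond (G : mgraph) (ple : rel (edge G))
    (A : finZmodType) (b : {ffun vert G -> A}) (T : {set edge G}) : bool :=
  [exists B : {set edge G}, compatible_bond b B &&
    [exists e in B, [forall f in B, ple f e] && (T == B :\ e)]].

Definition nbb_sets (G : mgraph) (ple : rel (edge G))
    (A : finZmodType) (b : {ffun vert G -> A}) (i : nat) :
    {set {set edge G}} :=
  [set S : {set edge G} | [&& #|S| == i, compatible_del b S &
    [forall T : {set edge G},
       compatible_broken_bond ple b T ==> ~~ (T \subset S)]]].

(* Main.v *)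
Require Import Defs.
From HB Require Import structures.
From mathcomp Require Import all_boot all_order all_algebra.
Import GRing.Theory.
Local Open Scope ring_scope.

Import Num.Theory.
Set Implicit Arguments.
Unset Strict Implicit.
Unset Printing Implicit Defensive.

(** Whitney's broken-circuit argument, carried out on flows instead of on
    subsets of edges.

    Fix a finite group A and b, and let f range over the (A, b)-flows, with
    zero set Z.  If B is a b-compatible bond with greatest edge e, then summing
    the boundary of f over one side of B shows that the values of f on B, with
    suitable signs, add up to 0; so if f vanishes on the broken bond B - e, it
    also vanishes at e ([flow_vanishes_on_bond]).  Thus Z is closed under
    completing broken bonds.  For such a Z the sum of (-1)^|S| over the subsets
    S of Z that contain a broken bond is 0, since toggling the least edge that
    completes a broken bond inside S pairs these subsets with opposite signs.
    The sum over the other subsets of Z is therefore 1 if Z is empty and 0 if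
    not ([sum_sign_incompletable]), and summing over f gives

      F*(G, b; A) = sum of (-1)^|S| N(S) over S containing no broken bond,

    where N(S) is the number of (A, b)-flows that vanish on S
    ([num_nz_flows_avoiding]).

    If G - S is not b-compatible, then N(S) = 0.  If it is, N(S) is the size of
    a fibre of the boundary map of G - S, whose image consists of the functions
    that are locally zero-sum on G - S; counting these gives
    N(S) = |A|^(|E| - |S| - |V| + c(G - S)) ([card_flows_avoiding]).  When S also
    contains no broken bond, c(G - S) = c(G): otherwise S would contain a bond,
    and every bond inside a b-compatible S is itself b-compatible
    ([ncomp_avoiding]).  So N(S) = |A|^(m(G) - |S|), and F*(G, b; A) is the
    value at |A| of the polynomial whose coefficients count the sets S.

    To identify that polynomial with the assigning polynomial, replace (A, b) by
    (A x Z_n, (b, 0)) for all n >= 2: the same vertex sets are zero-sum, so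
    neither the assigning nor the sets S change, while the two polynomials are
    compared at infinitely many points. *)

(** * Alternating sums over sets without a completable subset *)

(** Adding or removing e pairs the sets of the family with opposite signs. *)
Lemma sum_sign_toggle (E : finType) (P : pred {set E}) (e : E) :
  (forall S : {set E}, e \notin S -> P (e |: S) = P S) ->
  \sum_(S | P S) (-1) ^+ #|S| = 0 :> rat.
Proof.
move=> Pe; rewrite (bigID (fun S : {set E} => e \in S)) /=.
rewrite (reindex_onto (fun S => e |: S) (fun S => S :\ e)) /=; last first.
  by move=> S /andP[_ eS]; rewrite setD1K.
rewrite (eq_bigl (fun S => P S && (e \notin S))); last first.
  move=> S; rewrite setU11 andbT; case: (boolP (e \in S)) => eS /=.
    rewrite andbF; apply/negbTE; apply/negP=> /andP[_ /eqP eq].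
    by move: eS; rewrite -eq setD11.
  by rewrite Pe // setU1K // eqxx.
rewrite -big_split big1 // => S /andP[_ eS].
by rewrite cardsU1 eS exprS mulN1r; exact: addNr.
Qed.

Lemma sum_sign_subset (E : finType) (Z : {set E}) :
  \sum_(S : {set E} | S \subset Z) (-1) ^+ #|S| = (Z == set0)%:R :> rat.
Proof.
have [->|[e eZ]] := set_0Vmem Z.
  by rewrite eqxx (big_pred1 set0) ?cards0 // => S; rewrite subset0.
rewrite (sum_sign_toggle (e := e)).
  by case: eqP eZ => // ->; rewrite inE.
by move=> S _; rewrite subUset sub1set eZ.
Qed.

Section Avoiding.
Variables (E : finType) (ple : rel E).
Hypotheses (ple_anti : antisymmetric ple) (ple_trans : transitive ple).
Hypothesis ple_total : total ple.
Variable Q : {set E} -> E -> bool.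
(* [Q T e] abstracts: T is a broken bond whose removed greatest edge is e. *)
Hypothesis Q_max : forall T e f, Q T e -> f \in T -> ple f e && (f != e).

Definition completable (S : {set E}) (e : E) : bool :=
  [exists T : {set E}, Q T e && (T \subset S)].

Definition least_completable (S : {set E}) (e : E) : bool :=
  completable S e && [forall f, completable S f ==> ple e f].

Let ple_refl : reflexive ple.
Proof. by move=> x; case/orP: (ple_total x x). Qed.

(** Bookkeeping for grouping the sets that can be completed by the least edge
    that does so, without choosing a default edge for the other sets. *)
Lemma sum_least_completable (S : {set E}) (x : rat) :
  \sum_(e | least_completable S e) x =
    if [exists e, completable S e] then x else 0.
Proof.
case: existsP => [[e0 e0S]|noS]; last first.
  rewrite big_pred0 // => e; apply/negP=> /andP[eS _].
  by apply: noS; exists e.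
case: (extremumP id ple_refl ple_trans ple_total e0S) => e eS emin.
rewrite (big_pred1 e) // => f; apply/andP/eqP => [[fS /forallP fmin]|->].
  by apply: ple_anti; rewrite (implyP (fmin e)) //= emin.
by split=> //; apply/forallP=> g; apply/implyP; apply: emin.
Qed.

(** If f completes T, then T lies strictly below f; so T does not contain e when
    e is f or is not below f, and deleting e from the set keeps T inside it. *)
Lemma completable_setU1 (S : {set E}) (e f : E) :
  completable (e |: S) f -> ~~ ple e f || (f == e) -> completable S f.
Proof.
case/existsP=> T /andP[QT TS] ef; apply/existsP; exists T; rewrite QT /=.
suff eT : e \notin T.
  apply/subsetP=> g gT; have := subsetP TS g gT.
  by rewrite !inE => /orP[/eqP ge|//]; rewrite ge (negbTE eT) in gT.
apply/negP=> eT; have /andP[le_ef ne_ef] := Q_max QT eT.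
by move: ef; rewrite le_ef /= eq_sym (negbTE ne_ef).
Qed.

Lemma completable_mono (S S' : {set E}) (e : E) :
  S \subset S' -> completable S e -> completable S' e.
Proof.
move=> SS' /existsP[T /andP[QT TS]]; apply/existsP; exists T.
by rewrite QT (subset_trans TS).
Qed.

(** Toggling the least completing edge leaves it the least completing edge;
    this is what makes the pairing below an involution. *)
Lemma least_completable_setU1 (S : {set E}) (e : E) :
  least_completable (e |: S) e = least_completable S e.
Proof.
apply/andP/andP=> -[eS /forallP emin]; split.
- by apply: completable_setU1 eS _; rewrite eqxx orbT.
- apply/forallP=> f; apply/implyP=> fS; apply: implyP (emin f) _.
  by apply: completable_mono fS; apply: subsetUr.
- by apply: completable_mono eS; apply: subsetUr.
- apply/forallP=> f; apply/implyP=> fS; case: (boolP (ple e f)) => // lt_fe.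
  have := implyP (emin f); rewrite (negbTE lt_fe); apply.
  by apply: completable_setU1 fS _; rewrite lt_fe.
Qed.

(** Closedness of Z keeps the pairing inside the subsets of Z, so the sets that
    can be completed cancel out of the alternating sum over all subsets. *)
Lemma sum_sign_incompletable (Z : {set E}) :
  (forall T e, Q T e -> T \subset Z -> e \in Z) ->
  \sum_(S : {set E} | (S \subset Z) && ~~ [exists e, completable S e])
     (-1) ^+ #|S| = (Z == set0)%:R :> rat.
Proof.
move=> Zclosed; rewrite -sum_sign_subset.
rewrite [RHS](bigID (fun S : {set E} => [exists e, completable S e])) /=.
suff -> : \sum_(S : {set E} | (S \subset Z) && [exists e, completable S e])
     (-1) ^+ #|S| = 0 :> rat by rewrite add0r.
rewrite big_mkcondr /=.
under eq_bigr do rewrite -sum_least_completable.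
rewrite (exchange_big_dep predT) //= big1 // => e _.
apply: (sum_sign_toggle (e := e)) => S _ /=; rewrite least_completable_setU1.
rewrite subUset sub1set; case: (boolP (e \in Z)) => //= eZ.
apply/esym/negP=> /andP[SZ /andP[/existsP[T /andP[QT TS]] _]].
by rewrite (Zclosed _ _ QT (subset_trans TS SZ)) in eZ.
Qed.

End Avoiding.

(** * Counting fibres of additive maps *)

(** The fibres over Y are translates of the kernel, so they all have the same
    size. *)
Lemma card_fibre (I J : finType) (A : finZmodType)
    (X : {set {ffun I -> A}}) (Y : {set {ffun J -> A}})
    (phi : {ffun I -> A} -> {ffun J -> A}) (y : {ffun J -> A}) :
  (forall x x', x \in X -> x' \in X -> (x - x' \in X) /\ (x + x' \in X)) ->
  (forall x x', phi (x - x') = phi x - phi x') ->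
  phi @: X = Y -> y \in Y ->
  (#|[set x in X | phi x == y]| * #|Y| = #|X|)%N.
Proof.
move=> XB phiB phiX Yy.
have phiD x x' : phi (x + x') = phi x + phi x'.
  by rewrite -[x in RHS](addrK x') phiB subrK.
have fib z : z \in Y ->
    #|[set x in X | phi x == z]| = #|[set x in X | phi x == 0]|.
  rewrite -phiX => /imsetP[x0 Xx0 ->].
  rewrite -[RHS](card_imset _ (addIr x0)); apply: eq_card => x.
  apply/idP/imsetP => [|[x1]]; rewrite !inE => /andP[Xx /eqP phix].
    exists (x - x0); last by rewrite subrK.
    by rewrite inE (XB _ _ Xx Xx0).1 phiB phix subrr eqxx.
  by move=> ->; rewrite (XB _ _ Xx Xx0).2 phiD phix add0r eqxx.
rewrite (fib y Yy) -[#|X|]sum1_card (partition_big phi (mem Y)) /=; last first.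
  by move=> x Xx; rewrite -phiX imset_f.
rewrite mulnC -sum_nat_const; apply: eq_bigr => z Yz.
by rewrite -(fib z Yz) sum1dep_card; apply: eq_card => x; rewrite !inE.
Qed.

Lemma card_ffun_vanishing (I : finType) (A : finZmodType) (P : {set I}) :
  #|[set f : {ffun I -> A} | [forall i in P, f i == 0]]| = (#|A| ^ #|~: P|)%N.
Proof.
have <- := card_pffun_on (0 : A) (~: P) predT.
apply: eq_card => f; rewrite inE.
apply/forall_inP/pffun_onP => [fP|[fP _] i iP].
  split=> //; apply/subsetP=> i; rewrite !inE => fi; apply: contra fi; exact: fP.
apply/negPn/negP=> fi; have := subsetP fP i; rewrite !inE iP; exact/implyP.
Qed.

(** * Connectivity after deleting edges, and bonds *)

Section Graph.
Variable G : mgraph.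
Implicit Types (S T B : {set edge G}) (e : edge G) (u v w : vert G).

Definition joined S : rel (vert G) := connect (@adj (del_edges S)).

Lemma adj_delP S u v :
  reflect (exists2 e, e \notin S & (src e = u /\ tgt e = v) \/
                                   (src e = v /\ tgt e = u))
          (@adj (del_edges S) u v).
Proof.
apply: (iffP existsP) => [[[e eS] /=]|[e eS uv]].
  move=> uv; exists e => //.
  by case/orP: uv => /andP[/eqP-> /eqP->]; [left|right].
exists (exist _ e eS) => /=.
by case: uv => -[-> ->]; rewrite !eqxx ?orbT.
Qed.

Lemma adj_del_sym S : symmetric (@adj (del_edges S)).
Proof.
move=> u v; apply/adj_delP/adj_delP => -[e eS []]; exists e => //;
  by [right|left].
Qed.

Lemma joined_sym S : symmetric (joined S).
Proof. exact/sym_connect_sym/adj_del_sym. Qed.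

Lemma joined_edge S e : e \notin S -> joined S (src e) (tgt e).
Proof. by move=> eS; apply/connect1/adj_delP; exists e => //; left. Qed.

Lemma joined_closed S e u :
  e \notin S -> joined S u (tgt e) = joined S u (src e).
Proof.
move=> eS; have st := joined_edge eS.
have ts : joined S (tgt e) (src e) by rewrite joined_sym.
by apply/idP/idP => uv; apply: connect_trans uv _.
Qed.

Lemma joined_sub S T : S \subset T -> subrel (joined T) (joined S).
Proof.
move=> ST; apply: connect_sub => u v /adj_delP[e eT uv].
apply/connect1/adj_delP; exists e => //.
by apply: contra eT => /(subsetP ST).
Qed.

Lemma ncomp_delE S :
  ncomp (del_edges S) = #|[set [set v | joined S u v] | u : vert G]|.
Proof. by []. Qed.

Lemma ncomp_del0 : ncomp (del_edges (set0 : {set edge G})) = ncomp G.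
Proof.
rewrite ncomp_delE /ncomp /components; congr #|pred_of_set _|.
apply: eq_imset => u; apply/setP=> v; rewrite !inE; apply: eq_connect => {}u {}v.
apply/adj_delP/existsP => [[e _ uv]|[e uv]]; exists e; rewrite ?inE //.
  by case: uv => -[-> ->]; rewrite !eqxx ?orbT.
by case/orP: uv => /andP[/eqP-> /eqP->]; [left|right].
Qed.

Lemma ncomp_del_mono S T :
  S \subset T -> (ncomp (del_edges S) <= ncomp (del_edges T))%N.
Proof.
move=> ST; rewrite !ncomp_delE.
pose h (C : {set vert G}) := [set v | [exists u in C, joined S u v]].
suff -> : [set [set v | joined S u v] | u : vert G] =
    h @: [set [set v | joined T u v] | u : vert G] by apply: leq_imset_card.
rewrite -imset_comp; apply: eq_imset => u /=; apply/setP=> v; rewrite !inE.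
apply/idP/exists_inP => [uv|[w]].
  by exists u => //; rewrite inE; apply: connect0.
by rewrite inE => /(joined_sub ST); apply: connect_trans.
Qed.

(** If the ends of e were joined in G - B, putting e back would merge no
    components, and B - e would already be a cut, against minimality. *)
Lemma bond_separates B e :
  bond B -> e \in B -> ~~ joined B (src e) (tgt e).
Proof.
move=> /minsetP[/andP[B0 cutB] Bmin] eB; apply/negP=> join_e.
have eqj u : [set v | joined B u v] = [set v | joined (B :\ e) u v].
  apply/setP=> v; rewrite !inE; apply/idP/idP.
    by apply: joined_sub; apply: subD1set.
  apply: connect_sub => {}u {}v /adj_delP[f fB uv].
  have fj : joined B (src f) (tgt f).
    by case: (eqVneq f e) fB => [->|fe]; rewrite ?inE ?fe // => /joined_edge.
  have fj' : joined B (tgt f) (src f) by rewrite joined_sym.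
  by case: uv => -[<- <-].
have cut : (ncomp G < ncomp (del_edges (B :\ e)))%N.
  by rewrite ncomp_delE -(eq_imset _ eqj) -ncomp_delE.
have ne0 : B :\ e != set0 by apply: contraTneq cut => ->; rewrite ncomp_del0 ltnn.
have := Bmin _ (introT andP (conj ne0 cut)) (subD1set _ _).
by move=> eq; move: eB; rewrite -eq setD11.
Qed.

End Graph.

(** * Flows and their boundaries *)

Section Flows.
Variables (G : mgraph) (A : finZmodType).
Implicit Types (S T B : {set edge G}) (e : edge G) (u v w : vert G).
Implicit Types (b : {ffun vert G -> A}) (f : {ffun edge G -> A}).

Lemma compatible_delP b S :
  reflect (forall u, \sum_(v | joined S u v) b v = 0) (compatible_del b S).
Proof.
apply: (iffP forall_inP) => [bS u|bS C /imsetP[u _ ->]].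
  have /eqP := bS _ (imset_f (fun u => [set v | joined S u v]) (isT : u \in predT)).
  by apply: etrans; apply: eq_bigl => v; rewrite inE.
by apply/eqP; rewrite -[RHS](bS u); apply: eq_bigl => v; rewrite inE.
Qed.

Lemma sum_boundary f (C : {set vert G}) :
  \sum_(v in C) boundary f v =
  \sum_(e | tgt e \in C) f e - \sum_(e | src e \in C) f e.
Proof.
rewrite (partition_big (@tgt G) (mem C)) //.
rewrite [X in _ - X](partition_big (@src G) (mem C)) // -sumrB.
apply: eq_bigr => v vC; rewrite ffunE; congr (_ - _); apply: eq_bigl => e.
  by case: eqP => [->|_]; rewrite ?vC ?andbF.
by case: eqP => [->|_]; rewrite ?vC ?andbF.
Qed.

Lemma boundaryB f g : boundary (f - g) = boundary f - boundary g.
Proof.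
apply/ffunP=> v; rewrite !ffunE.
under eq_bigr do rewrite !ffunE.
under [X in _ - X = _]eq_bigr do rewrite !ffunE.
by rewrite !sumrB !opprB addrACA [RHS]addrACA; congr (_ + _); rewrite addrC.
Qed.

(** An edge outside S has both ends in the same component of G - S, so its two
    contributions to the sum over a component cancel. *)
Lemma boundary_compatible f S :
  (forall e, e \in S -> f e = 0) -> compatible_del (boundary f) S.
Proof.
move=> fS; apply/compatible_delP=> u.
under eq_bigl do rewrite -[joined _ _ _]in_set.
rewrite sum_boundary big_mkcond [X in _ - X]big_mkcond -sumrB big1 // => e _.
rewrite !inE; case: (boolP (e \in S)) => [/fS->|eS]; first by rewrite !if_same subrr.
by rewrite joined_closed // subrr.
Qed.

(** The component of G - B at the tail of e does not contain the head of e, so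
    in the zero sum of the boundary over that component the only possibly
    nonzero term left is the value at e. *)
Lemma flow_vanishes_on_bond b B e f :
  compatible_bond b B -> e \in B -> boundary f = b ->
  (forall e', e' \in B :\ e -> f e' = 0) -> f e = 0.
Proof.
move=> /andP[bondB /compatible_delP bB] eB fb f0.
have := bB (src e); under eq_bigl do rewrite -[joined _ _ _]in_set.
rewrite -fb sum_boundary big_mkcond [X in _ - X]big_mkcond -sumrB.
rewrite (bigD1 e) //= big1 => [|e' e'e].
  rewrite !inE (negbTE (bond_separates bondB eB)) [joined _ _ _]connect0.
  by rewrite sub0r addr0 => /eqP; rewrite oppr_eq0 => /eqP.
rewrite !inE; case: (boolP (e' \in B)) => [e'B|e'B].
  by rewrite f0 ?inE ?e'e // !if_same subrr.
by rewrite joined_closed // subrr.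
Qed.

(** The image of the boundary map of G - S. *)
Definition avoiding_boundary S b : Prop :=
  exists2 f : {ffun edge G -> A}, forall e, e \in S -> f e = 0 & boundary f = b.

Lemma avoiding_boundaryB S b b' :
  avoiding_boundary S b -> avoiding_boundary S b' -> avoiding_boundary S (b - b').
Proof.
move=> [f fS <-] [f' f'S <-]; exists (f - f'); last by rewrite boundaryB.
by move=> e eS; rewrite !ffunE fS // f'S // subrr.
Qed.

Lemma avoiding_boundary0 S : avoiding_boundary S 0.
Proof.
exists 0; first by move=> e _; rewrite ffunE.
by rewrite -[X in boundary X](subrr 0) boundaryB subrr.
Qed.

Lemma avoiding_boundaryD S b b' :
  avoiding_boundary S b -> avoiding_boundary S b' -> avoiding_boundary S (b + b').
Proof.
move=> hb hb'; rewrite -[b']opprK -[- b']sub0r.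
by apply/avoiding_boundaryB/avoiding_boundaryB => //; apply: avoiding_boundary0.
Qed.

Definition point_mass v (x : A) : {ffun vert G -> A} :=
  [ffun w => if w == v then x else 0].

(** Send x along a path from u to v. *)
Lemma avoiding_boundary_joined S u v x :
  joined S u v -> avoiding_boundary S (point_mass v x - point_mass u x).
Proof.
case/connectP=> p; elim: p u => [|w p IH] u /=.
  by move=> _ ->; rewrite subrr; apply: avoiding_boundary0.
case/andP=> /adj_delP[e eS uw] /IH{}IH /IH{}IH.
rewrite -(subrK (point_mass w x) (point_mass v x)) -addrA.
apply: avoiding_boundaryD => {IH} //.
have ew : avoiding_boundary S (point_mass (tgt e) x - point_mass (src e) x).
  exists [ffun e' => if e' == e then x else 0].
    by move=> e' e'S; rewrite ffunE; case: eqP e'S => // ->; rewrite (negbTE eS).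
  apply/ffunP=> z; rewrite !ffunE ![z == _]eq_sym.
  by congr (_ - _); under eq_bigr do rewrite ffunE;
    rewrite -big_mkcondr /= big_mkcondl big_pred1_eq.
case: uw ew => -[-> ->] // ew.
rewrite -opprB -[- _]sub0r; apply: avoiding_boundaryB ew.
exact: avoiding_boundary0.
Qed.

(** Move the value of b at every vertex to the root of its component in G - S:
    what arrives at each root is a component sum, which is 0. *)
Lemma compatible_avoiding_boundary S b :
  compatible_del b S -> avoiding_boundary S b.
Proof.
move=> /compatible_delP bS.
pose rt := fingraph.root (@adj (del_edges S)).
have jsym : connect_sym (@adj (del_edges S)) by exact: (@joined_sym G S).
have -> : b = \sum_v (point_mass v (b v) - point_mass (rt v) (b v)).
  apply/ffunP=> w; rewrite sum_ffunE.
  under eq_bigr do rewrite !ffunE.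
  rewrite sumrB -!big_mkcond (big_pred1 w) /=; last by move=> v; rewrite eq_sym.
  suff -> : \sum_(v | w == rt v) b v = 0 by rewrite subr0.
  case: (eqVneq (rt w) w) => [rw|rw].
    rewrite -[RHS](bS w); apply: eq_bigl => v.
    by rewrite -{1}rw /rt (root_connect jsym).
  rewrite big_pred0 // => v; apply/negP=> /eqP wv.
  by move: rw; rewrite wv /rt (root_root jsym) eqxx.
apply: big_ind => [||v _]; [exact: avoiding_boundary0|exact: avoiding_boundaryD|].
apply: avoiding_boundary_joined; rewrite joined_sym.
exact: connect_root.
Qed.

(** The b that are locally zero-sum on G - S form the kernel of the map taking
    b to its component sums, which reaches every assignment of values to the
    components. *)
Lemma card_compatible S :
  (#|[set b : {ffun vert G -> A} | compatible_del b S]| *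
     #|A| ^ ncomp (del_edges S) = #|A| ^ #|vert G|)%N.
Proof.
pose C := [set [set v | joined S u v] | u : vert G].
pose phi b : {ffun {set vert G} -> A} :=
  [ffun X => if X \in C then \sum_(v in X) b v else 0].
pose Y := [set y : {ffun {set vert G} -> A} | [forall X in ~: C, y X == 0]].
have phiY : phi @: [set: {ffun vert G -> A}] = Y.
  apply/setP=> y; rewrite inE; apply/imsetP/forall_inP => [[b _ ->] X|yC].
    by rewrite inE ffunE => /negbTE->.
  pose rt := fingraph.root (@adj (del_edges S)).
  have jsym : connect_sym (@adj (del_edges S)) by exact: (@joined_sym G S).
  exists [ffun v => if rt v == v then y [set w | joined S v w] else 0] => //.
  apply/ffunP=> X; rewrite ffunE; case: ifP => [/imsetP[u _ ->]|XC]; last first.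
    by apply/eqP/yC; rewrite inE XC.
  have ru : joined S u (rt u) by apply: connect_root.
  rewrite (bigD1 (rt u)) ?inE //= ffunE /rt root_root // eqxx big1 ?addr0.
    congr (y _); apply/setP=> v; rewrite !inE.
    exact: (same_connect jsym ru).
  move=> v /andP[]; rewrite inE ffunE => uv vu.
  case: eqP => // rv; case/eqP: vu; rewrite -{1}rv; apply/eqP.
  by rewrite (root_connect jsym) jsym.
have Y0 : 0 \in Y by rewrite inE; apply/forall_inP => X _; rewrite ffunE.
have phiB b b' : phi (b - b') = phi b - phi b'.
  apply/ffunP=> X; rewrite !ffunE; case: ifP => _; last by rewrite subrr.
  by under eq_bigr do rewrite !ffunE; rewrite sumrB.
have := card_fibre (fun _ _ _ _ => conj (in_setT _) (in_setT _)) phiB phiY Y0.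
rewrite cardsT card_ffun card_ffun_vanishing setCK => <-; congr (_ * _)%N.
apply: eq_card => b; rewrite !inE /=; apply/idP/eqP => [/forall_inP bS|phib].
  by apply/ffunP=> X; rewrite !ffunE; case: ifP => // XC; apply/eqP/bS.
apply/forall_inP=> X XC; move/ffunP/(_ X): phib; rewrite !ffunE XC => ->.
by rewrite eqxx.
Qed.

Definition flows_avoiding b S : {set {ffun edge G -> A}} :=
  [set f | (boundary f == b) && [forall e in S, f e == 0]].

Lemma flows_avoiding_incompatible b S :
  ~~ compatible_del b S -> flows_avoiding b S = set0.
Proof.
move=> bS; apply/setP=> f; rewrite !inE; apply/negbTE; apply: contra bS.
case/andP=> /eqP<- /forall_inP fS; apply: boundary_compatible => e /fS/eqP.
exact.
Qed.

(** The exponent |~: S| + c(G - S) - |V| would be the cycle rank of G - S; the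
    factor |A|^|V| on the left avoids the subtraction. *)
Lemma card_flows_avoiding b S :
  compatible_del b S ->
  (#|flows_avoiding b S| * #|A| ^ #|vert G| =
   #|A| ^ (#|~: S| + ncomp (del_edges S)))%N.
Proof.
move=> bS; rewrite -(card_compatible S) mulnA expnD; congr (_ * _)%N.
pose X := [set f : {ffun edge G -> A} | [forall e in S, f e == 0]].
have XP f : reflect (forall e, e \in S -> f e = 0) (f \in X).
  by rewrite inE; apply: (iffP forall_inP) => fS e /fS; [move/eqP|move->].
have Xb : @boundary G A @: X = [set b : {ffun vert G -> A} | compatible_del b S].
  apply/setP=> c; rewrite inE; apply/imsetP/idP => [[f /XP fX ->]|].
    exact: boundary_compatible.
  by case/compatible_avoiding_boundary=> f fS <-; exists f => //; apply/XP.
have XB f f' : f \in X -> f' \in X -> f - f' \in X /\ f + f' \in X.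
  move=> /XP fX /XP f'X.
  by split; apply/XP => e eS; rewrite !ffunE fX // f'X // ?subr0 ?addr0.
rewrite -card_ffun_vanishing -(card_fibre XB boundaryB Xb (y := b)) ?inE //.
by congr (_ * _)%N; apply: eq_card => f; rewrite !inE andbC.
Qed.

(** Compatibility of S means that some flow vanishes on S, which is inherited
    by subsets. *)
Lemma compatible_del_sub b S T :
  S \subset T -> compatible_del b T -> compatible_del b S.
Proof.
move=> ST /compatible_avoiding_boundary[f fT <-].
by apply: boundary_compatible => e /(subsetP ST); apply: fT.
Qed.

End Flows.

(** * Nowhere-zero flows and broken bonds *)

Section NBB.
Variables (G : mgraph) (ple : rel (edge G)).
Hypotheses (ple_anti : antisymmetric ple) (ple_trans : transitive ple).
Hypothesis ple_total : total ple.
Variables (A : finZmodType) (b : {ffun vert G -> A}).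
Implicit Types (S T B Z : {set edge G}) (e : edge G).

Definition avoids_broken_bonds S : bool :=
  [forall T : {set edge G}, compatible_broken_bond ple b T ==> ~~ (T \subset S)].

Definition broken_at T e : bool :=
  [exists B : {set edge G}, [&& compatible_bond b B, e \in B,
     [forall f in B, ple f e] & T == B :\ e]].

Lemma avoids_broken_bondsE S :
  avoids_broken_bonds S = ~~ [exists e, completable broken_at S e].
Proof.
apply/forallP/existsPn => [noT e|noe T].
  apply/existsP=> -[T /andP[/existsP[B /and4P[bB eB emax TB]] TS]].
  have := noT T; rewrite TS implybF => /existsP[]; exists B; rewrite bB /=.
  by apply/exists_inP; exists e => //; rewrite emax.
apply/implyP=> /existsP[B /andP[bB /exists_inP[e eB /andP[emax TB]]]].
apply: contra (noe e) => TS; apply/existsP; exists T; rewrite TS andbT.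
by apply/existsP; exists B; rewrite bB eB emax.
Qed.

(** If G - S had more components than G, then S would contain a bond B, which
    is compatible because S is; S would then contain its broken bond. *)
Lemma ncomp_avoiding S :
  compatible_del b S -> avoids_broken_bonds S ->
  ncomp (del_edges S) = ncomp G.
Proof.
move=> bS /forallP noT; apply/eqP; have := ncomp_del_mono (sub0set S).
rewrite ncomp_del0 eqn_leq => ->; rewrite andbT leqNgt; apply/negP=> cut.
have S0 : S != set0 by apply: contraTneq cut => ->; rewrite ncomp_del0 ltnn.
have [B bondB BS] : {B | bond B & B \subset S}.
  by apply: minset_exists; rewrite S0.
have /set0Pn[e0 e0B] : B != set0 by case/minsetP: bondB => /andP[].
have ge_refl : reflexive (fun e f => ple f e).
  by move=> e; case/orP: (ple_total e e).
have ge_trans : transitive (fun e f => ple f e).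
  by move=> f e g ef fg; apply: ple_trans fg ef.
have ge_total : total (fun e f => ple f e) by move=> e f; apply: ple_total.
have [e eB emax] := extremumP (P := mem B) id ge_refl ge_trans ge_total e0B.
suff broken_e : compatible_broken_bond ple b (B :\ e).
  by have := noT (B :\ e); rewrite broken_e (subset_trans (subD1set _ _) BS).
apply/existsP; exists B; rewrite /compatible_bond bondB.
rewrite (compatible_del_sub BS bS); apply/exists_inP; exists e => //.
by rewrite eqxx andbT; apply/forall_inP.
Qed.

(** Detect the empty zero set of a flow by an alternating sum over the subsets
    that avoid broken bonds, then exchange the two sums. *)
Lemma num_nz_flows_avoiding :
  (num_nz_flows b)%:R =
  \sum_(S | avoids_broken_bonds S) (-1) ^+ #|S| * #|flows_avoiding b S|%:R :> rat.
Proof.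
pose zeros (f : {ffun edge G -> A}) := [set e | f e == 0].
have zerosE f S : (S \subset zeros f) = [forall e in S, f e == 0].
  by apply/subsetP/forall_inP => fS e /fS; rewrite inE.
have broken_max T e f : broken_at T e -> f \in T -> ple f e && (f != e).
  case/existsP=> B /and4P[_ _ /forall_inP emax /eqP->].
  by rewrite !inE => /andP[-> /emax->].
transitivity (\sum_(f | boundary f == b) (zeros f == set0)%:R : rat).
  rewrite /num_nz_flows -sum1dep_card natr_sum big_mkcondr /=.
  apply: eq_bigr => f _; rewrite -subset0.
  have -> : (zeros f \subset set0) = [forall e, f e != 0].
    by apply/subsetP/forallP => fn e; have := fn e; rewrite !inE;
      [case: eqP => // _ /(_ isT) | move/negbTE->].
  by case: ifP.
transitivity (\sum_(f | boundary f == b)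
    \sum_(S : {set edge G} | (S \subset zeros f) && avoids_broken_bonds S)
      (-1) ^+ #|S| : rat).
  apply: eq_bigr => f /eqP fb.
  rewrite -(sum_sign_incompletable ple_anti ple_trans ple_total broken_max).
    by apply: eq_bigl => S; rewrite avoids_broken_bondsE.
  move=> T e /existsP[B /and4P[bB eB _ /eqP->]] /subsetP fT; rewrite inE.
  apply/eqP/(flow_vanishes_on_bond bB eB fb) => e' /fT.
  by rewrite inE => /eqP.
rewrite (exchange_big_dep avoids_broken_bonds) => [|f S _ /andP[]//].
apply: eq_bigr => S avS; rewrite mulr_natr -sumr_const; apply: eq_bigl => f.
by rewrite avS andbT inE zerosE.
Qed.

(** The fibre is nonempty, so its size, a power of |A|, is at least 1; as
    |A| > 1, comparing exponents bounds |S|. *)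
Lemma card_flows_avoiding_broken_bonds S :
  (1 < #|A|)%N -> compatible_del b S -> avoids_broken_bonds S ->
  (#|S| <= betti G)%N /\ #|flows_avoiding b S| = (#|A| ^ (betti G - #|S|))%N.
Proof.
move=> A1 bS avS; have := card_flows_avoiding bS; rewrite (ncomp_avoiding bS avS).
set N := #|flows_avoiding b S| => countN.
have A0 : (0 < #|A|)%N by apply: ltnW.
have N0 : (0 < N)%N.
  rewrite lt0n; apply: contraTneq (isT : true) => N0.
  by have := expn_gt0 #|A| (#|~: S| + ncomp G); rewrite -countN N0 A0.
have leV : (#|vert G| <= #|~: S| + ncomp G)%N.
  by rewrite -(leq_exp2l _ _ A1) -countN leq_pmull.
have cE := cardsC S.
have leb : (#|S| <= betti G)%N.
  rewrite /betti -cE -addnA leq_subRL; last first.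
    by rewrite (leq_trans leV) // leq_addl.
  by rewrite addnC leq_add2l.
split=> //; apply/eqP; rewrite -(eqn_pmul2r (_ : 0 < #|A| ^ #|vert G|)%N).
  rewrite countN -expnD eqn_exp2l // /betti -subnDA [(#|vert G| + _)%N]addnC.
  rewrite -cE -addnA subnDl subnK //.
by rewrite expn_gt0 A0.
Qed.

Lemma num_nz_flows_nbb :
  (1 < #|A|)%N ->
  (num_nz_flows b)%:R = \sum_(i < (betti G).+1)
     (-1) ^+ i * #|nbb_sets ple b i|%:R * #|A|%:R ^+ (betti G - i) :> rat.
Proof.
move=> A1; rewrite num_nz_flows_avoiding.
rewrite (bigID (fun S => compatible_del b S)) /=.
rewrite [X in _ + X]big1 ?addr0 => [|S /andP[_ bS]]; last first.
  by rewrite flows_avoiding_incompatible // cards0 mulr0.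
have le_betti S : avoids_broken_bonds S && compatible_del b S ->
    (#|S| < (betti G).+1)%N.
  by case/andP=> avS bS; case: (card_flows_avoiding_broken_bonds A1 bS avS).
rewrite (partition_big (fun S => inord #|S| : 'I_(betti G).+1) predT) //=.
apply: eq_bigr => i _.
rewrite mulrAC mulr_natr -sumr_const; apply: eq_big => [S|S /andP[bavS /eqP <-]].
  rewrite inE -/(avoids_broken_bonds S) [_ && avoids_broken_bonds S]andbC andbC.
  case: (boolP (_ && compatible_del b S)) => [bavS|]; last by rewrite !andbF.
  by rewrite -val_eqE /= inordK ?le_betti.
case/andP: (bavS) => avS bS.
rewrite inordK ?le_betti //.
by have [_ ->] := card_flows_avoiding_broken_bonds A1 bS avS; rewrite natrX.
Qed.

End NBB.

(** * Passing to polynomials *)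

Lemma poly_eq_at_multiples (P Q : {poly rat}) (q : nat) :
  (0 < q)%N -> (forall n, P.[(q * n.+2)%:R] = Q.[(q * n.+2)%:R]) -> P = Q.
Proof.
move=> q0 PQ; apply/eqP; rewrite -subr_eq0; apply/negPn/negP=> d0.
pose rs : seq rat := [seq (q * n.+2)%:R | n <- iota 0 (size (P - Q))].
have := max_poly_roots (rs := rs) d0; rewrite size_map size_iota ltnn.
case/(_ _ _)/notF.
  by apply/allP=> _ /mapP[n _ ->]; rewrite rootE !hornerE PQ subrr.
rewrite map_inj_uniq ?iota_uniq // => m n /eqP.
by rewrite eqr_nat eqn_pmul2l // => /eqP[].
Qed.

Lemma coef_sum_scale_rev (m : nat) (c : 'I_m.+1 -> rat) (i : 'I_m.+1) :
  (\sum_(j < m.+1) c j *: 'X^(m - j))`_(m - i) = c i.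
Proof.
rewrite coef_sum (bigD1 i) //= coefZ coefXn eqxx mulr1 big1 ?addr0 // => j ji.
rewrite coefZ coefXn; case: eqP => [eq|]; last by rewrite mulr0.
case/eqP: ji; apply/val_inj.
by rewrite /= -[LHS](subKn (leq_ord j)) -eq subKn // leq_ord.
Qed.

Section Enlarge.
Variables (G : mgraph) (A : finZmodType) (b : {ffun vert G -> A}) (n : nat).

(** Z_(n + 2) rather than Z_(n + 1), so that the product is never the trivial
    group. *)
Definition prod_cyclic : finZmodType :=
  HB.pack (A * 'I_n.+2)%type (GRing.Zmodule.on (A * 'I_n.+2)%type)
    (Finite.on (A * 'I_n.+2)%type).

Definition extend_zero : {ffun vert G -> prod_cyclic} :=
  [ffun v => (b v, 0) : prod_cyclic].

Lemma card_prod_cyclic : #|prod_cyclic| = (#|A| * n.+2)%N.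
Proof. by rewrite card_prod card_ord. Qed.

Lemma sum_extend_zero (P : pred (vert G)) :
  (\sum_(v | P v) extend_zero v == 0) = (\sum_(v | P v) b v == 0).
Proof.
have -> : \sum_(v | P v) extend_zero v = (\sum_(v | P v) b v, 0) :> prod_cyclic.
  apply: (big_ind2 (fun (x : prod_cyclic) y => x = (y, 0))) => // [x y x' y' -> ->|v _].
    by congr (_, _); rewrite addr0.
  by rewrite ffunE.
by apply/eqP/eqP => [[]|->].
Qed.

Lemma compatible_extend_zero : compatible_del extend_zero =1 compatible_del b.
Proof. by move=> S; apply: eq_forallb => C; rewrite sum_extend_zero. Qed.

Lemma assigning_extend_zero :
  induced_assigning extend_zero = induced_assigning b.
Proof. by apply/ffunP=> X; rewrite !ffunE sum_extend_zero. Qed.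

Lemma Zsum_extend_zero : (extend_zero \in Zsum G _) = (b \in Zsum G A).
Proof. by rewrite !inE; apply: eq_forallb => C; rewrite sum_extend_zero. Qed.

Lemma nbb_sets_extend_zero (ple : rel (edge G)) (i : nat) :
  nbb_sets ple extend_zero i = nbb_sets ple b i.
Proof.
apply/setP=> S; rewrite !inE compatible_extend_zero; congr [&& _, _ & _].
apply: eq_forallb => T; congr (_ ==> _); apply: eq_existsb => B.
by rewrite /compatible_bond compatible_extend_zero.
Qed.

End Enlarge.

Theorem theorem1p5 (G : mgraph) (ple : rel (edge G))
    (ple_anti : antisymmetric ple) (ple_trans : transitive ple)
    (ple_total : total ple)
    (alpha : assigning G)
    (A : finZmodType) (b : {ffun vert G -> A})
    (bZ : b \in Zsum G A) (alphaE : alpha = induced_assigning b)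
    (F : {poly rat}) (F_alpha : is_assigning_polynomial alpha F)
    (a : 'I_(betti G).+1 -> rat)
    (FE : F = \sum_(i < (betti G).+1)
                ((-1) ^+ i * a i) *: 'X^(betti G - i)) :
  forall i : 'I_(betti G).+1, a i = #|nbb_sets ple b i|%:R.
Proof.
have A_gt0 : (0 < #|A|)%N by apply/card_gt0P; exists 0.
pose P : {poly rat} := \sum_(i < (betti G).+1)
  ((-1) ^+ i * #|nbb_sets ple b i|%:R) *: 'X^(betti G - i).
have FP : F = P.
  apply: (poly_eq_at_multiples A_gt0) => n.
  have bnZ : extend_zero b n \in Zsum G _ by rewrite Zsum_extend_zero.
  have bn_alpha : induced_assigning (extend_zero b n) = alpha.
    by rewrite assigning_extend_zero.
  have A_gt1 : (1 < #|prod_cyclic A n|)%N.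
    by rewrite card_prod_cyclic (leq_trans _ (leq_pmull _ A_gt0)).
  have := F_alpha.2 _ _ bnZ bn_alpha; rewrite card_prod_cyclic => ->.
  rewrite (num_nz_flows_nbb ple_anti ple_trans ple_total _ A_gt1) horner_sum.
  apply: eq_bigr => i _.
  by rewrite nbb_sets_extend_zero card_prod_cyclic !hornerE.
move=> i; have := congr1 (fun Q : {poly rat} => Q`_(betti G - i)) FP.
by rewrite FE !coef_sum_scale_rev; apply/mulfI; rewrite signr_eq0.
Qed.
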